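(* Let $f:\mathbb{R}^d\to\mathbb{R}$ be differentiable with $f_\star:=\inf_{\boldsymbol{x}\in\mathbb{R}^d}f(\boldsymbol{x})>-\infty$ and $f^\star:=\sup_{\boldsymbol{x}\in\mathbb{R}^d}f(\boldsymbol{x})<+\infty$, and suppose there is $\boldsymbol{L}\in\mathbb{R}_{>0}^d$ such that $|f(\boldsymbol{x})-f(\boldsymbol{y})-\langle\nabla f(\boldsymbol{y}),\boldsymbol{x}-\boldsymbol{y}\rangle|\le\frac12\|\boldsymbol{x}-\boldsymbol{y}\|_{\boldsymbol{L}}^2$ for all $\boldsymbol{x},\boldsymbol{y}\in\mathbb{R}^d$. Suppose the stochastic gradients $\boldsymbol{g}_t$ satisfy $\mathbb{E}_{t-1}[\boldsymbol{g}_t]=\nabla f(\boldsymbol{x}_t)$ and, for some $p\in(1,2]$ and $\boldsymbol{\sigma}\in\mathbb{R}_{\ge0}^d$, $\mathbb{E}_{t-1}[|\boldsymbol{\xi}_{t,i}|^p]\le\boldsymbol{\sigma}_i^p$ for all $i\in\{1,\dots,d\}$ and all $t$, where $\boldsymbol{\xi}_{t,i}:=\boldsymbol{g}_{t,i}-\nabla_i f(\boldsymbol{x}_t)$. Let $\Delta_\star:=f^\star-f_\star$. Then for any $\gamma>0$, $\lambda>0$ and $T\in\mathbb{N}$, the iterates of AdaGrad-Norm satisfy $$\mathbb{E}\left[\frac1T\sum_{t=1}^T\|\nabla f(\boldsymbol{x}_t)\|_2\right]\le\mathcal{O}\left(\frac{A}{\sqrt T}+\frac{\sqrt{B\|\boldsymbol{\sigma}\|_p}}{T^{\frac{p-1}{2p}}}\right),$$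 where $A:=\sqrt{\frac{\lambda\Delta_\star}{\gamma}}+\frac{\Delta_\star}{\gamma}+\gamma\|\boldsymbol{L}\|_\infty$ and $B:=\frac{\Delta_\star}{\gamma}+\gamma\|\boldsymbol{L}\|_\infty$.
   Context: $\mathbb{N}$ excludes $0$. For $\boldsymbol{L}\in\mathbb{R}_{>0}^d$, $\|\boldsymbol{x}\|_{\boldsymbol{L}}^2:=\sum_{i=1}^d\boldsymbol{L}_i\boldsymbol{x}_i^2$. $\nabla_i f$ is the $i$-th partial derivative. $\mathcal{O}(\cdot)$ hides a universal numerical constant. AdaGrad-Norm: given a (deterministic) initial point $\boldsymbol{x}_1\in\mathbb{R}^d$, learning rate $\gamma>0$ and hyperparameter $\lambda>0$, set $v_0=0$ and for $t=1,2,\dots$ query a random stochastic gradient $\boldsymbol{g}_t\in\mathbb{R}^d$ at $\boldsymbol{x}_t$ and set $v_t=v_{t-1}+\|\boldsymbol{g}_t\|_2^2$ and $\boldsymbol{x}_{t+1}=\boldsymbol{x}_t-\frac{\gamma}{\lambda+\sqrt{v_t}}\boldsymbol{g}_t$. $\mathcal{F}_t:=\sigma(\boldsymbol{g}_1,\dots,\boldsymbol{g}_t)$ is the natural filtration ($\mathcal{F}_0$ trivial) and $\mathbb{E}_t[\cdot]:=\mathbb{E}[\cdot\mid\mathcal{F}_t]$. *)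

(* Defs.v *)
From HB Require Import structures.
From mathcomp Require Export all_boot all_order all_algebra.
From mathcomp Require Export all_classical all_reals all_analysis.

Set Implicit Arguments.
Unset Strict Implicit.
Unset Printing Implicit Defensive.

Export Order.TTheory GRing.Theory Num.Theory.
Export numFieldNormedType.Exports.

Local Open Scope classical_set_scope.
Local Open Scope ring_scope.

Definition dotprod (R : realType) (d : nat) (u v : 'rV[R]_d) : R :=
  \sum_(i < d) u 0 i * v 0 i.

Definition l2norm (R : realType) (d : nat) (v : 'rV[R]_d) : R :=
  Num.sqrt (\sum_(i < d) v 0 i ^+ 2).

Definition lpnorm (R : realType) (d : nat) (p : R) (v : 'rV[R]_d) : R :=
  (\sum_(i < d) `|v 0 i| `^ p) `^ p^-1.

(* The normed-module structure on row vectors is that of the sup norm. *)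
Definition linfnorm (R : realType) (d : nat) (v : 'rV[R]_d) : R := `|v|.

(* The square of the L-weighted norm. *)
Definition sqwnorm (R : realType) (d : nat) (L v : 'rV[R]_d) : R :=
  \sum_(i < d) L 0 i * v 0 i ^+ 2.

Definition grad (R : realType) (d : nat) (f : 'rV[R]_d -> R) (x : 'rV[R]_d) :
    'rV[R]_d :=
  \row_(i < d) 'D_(delta_mx 0 i) f x.

Section adagrad_norm.
Context (R : realType) (d : nat) (Omega : Type).
Variables (x1 : 'rV[R]_d) (gamma lambda : R) (g : nat -> Omega -> 'rV[R]_d).

Definition adagrad_v (t : nat) (w : Omega) : R :=
  \sum_(1 <= s < t.+1) l2norm (g s w) ^+ 2.

(* Time starts at t = 1; the value at t = 0 is a dummy, and g 0 is unused. *)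
Fixpoint adagrad_x (t : nat) (w : Omega) : 'rV[R]_d :=
  if t is s.+1 then
    if s == 0%N then x1
    else adagrad_x s w
         - (gamma / (lambda + Num.sqrt (adagrad_v s w))) *: g s w
  else x1.

End adagrad_norm.

(* The sigma-algebra generated by g_1, ..., g_t, as a set of subsets of Omega:
   a random vector generates the same sigma-algebra as its coordinates. *)
Definition natural_filtration (R : realType) (d : nat) (Omega : Type)
    (g : nat -> Omega -> 'rV[R]_d) (t : nat) : set (set Omega) :=
  <<s [set A | exists s (i : 'I_d) (B : set R),
         [/\ (1 <= s <= t)%N, measurable B &
             A = (fun w => g s w 0 i) @^-1` B] ]>>.

(* Y is a version of the conditional expectation E[X | G], for an integrable
   X and a sub-sigma-algebra G. *)
Definition is_cond_expectation (R : realType) (disp : measure_display)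
    (Omega : measurableType disp) (P : probability Omega R)
    (G : set (set Omega)) (X Y : Omega -> R) : Prop :=
  [/\ P.-integrable setT (EFin \o X),
      P.-integrable setT (EFin \o Y),
      (forall B : set R, measurable B -> G (Y @^-1` B)) &
      forall A, G A ->
        (\int[P]_(w in A) (Y w)%:E = \int[P]_(w in A) (X w)%:E)%E].

(* Main.v *)
Require Import Defs.
From mathcomp Require Import ring lra measurable_realfun.

Set Implicit Arguments.
Unset Strict Implicit.
Unset Printing Implicit Defensive.

Local Open Scope classical_set_scope.
Local Open Scope ring_scope.

(** Why the bound holds.  Write [b_t = lambda + sqrt v_t] for the inverse step
    size divided by [gamma].  Smoothness along one step, multiplied by
    [b_t / gamma], bounds the correlation [<grad f x_t, g_t>] by
    [b_t (f x_t - f x_(t+1)) / gamma + gamma |L|_oo |g_t|^2 / (2 b_t)]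
    ([descent_step]).  As [b_t] is nondecreasing and [f] has range of length
    [Delta], an Abel summation of the first terms costs at most
    [b_T Delta / gamma]; the second ones telescope because
    [|g_t|^2 / b_t <= 2 (sqrt v_t - sqrt v_(t-1))].  Hence, on every path,
    [sum_t <grad f x_t, g_t> <= a + B sqrt v_T] with [a = lambda Delta / gamma]
    ([sum_correlation_le], [adagrad_correlation_le]).  Multiplying by [b_t]
    before taking expectations is the point: no weight correlated with [g_t]
    is left in front of [<grad f x_t, g_t>], whose expectation is therefore
    exactly that of [|grad f x_t|^2] ([cond_expectation_orthogonal]; the
    gradient is bounded since [f] is bounded and smooth, see [grad_bounded]).

    Put [Z = sqrt (sum_t |grad f x_t|^2)].  Then [sqrt v_T] is at most
    [2 (Z + W)], where [W] is the Euclidean norm of all the noise coordinates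
    up to time [T].  Since [p <= 2], [W] is bounded by their l^p norm, whose
    expectation is at most [T^(1/p) |sigma|_p] by Jensen
    ([sqrt_sum_sqr_le_lp], [Rintegral_powR_le]).  With [(E Z)^2 <= E Z^2] this
    gives the quadratic inequality
    [(E Z)^2 <= a + 2 B E Z + 2 B T^(1/p) |sigma|_p], hence
    [E Z <= sqrt a + 2 B + sqrt (2 B T^(1/p) |sigma|_p)]
    ([expectation_gradient_le]).  Finally the mean of the gradient norms is at
    most [Z / sqrt T], so the theorem holds with constant 2.  *)

(** * Real inequalities *)

Section real_inequalities.
Context (R : realType).

(** Every term is at most the l^p norm [N], so [a_i^2 <= |a_i|^p N^(2-p)], and
    these bounds add up to [N^p N^(2-p) = N^2]. *)
Lemma sqrt_sum_sqr_le_lp (I : finType) (p : R) (a : I -> R) :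
  0 < p -> p <= 2 ->
  Num.sqrt (\sum_i a i ^+ 2) <= (\sum_i `|a i| `^ p) `^ p^-1.
Proof.
move=> p0 p2.
have S0 : 0 <= \sum_i `|a i| `^ p by apply: sumr_ge0 => i _; exact: powR_ge0.
set S := \sum_i _ in S0 *.
have aS i : `|a i| <= S `^ p^-1.
  rewrite -[leLHS]powRr1// -(divff (lt0r_neq0 p0)) powRrM.
  apply: ge0_ler_powR; rewrite ?invr_ge0 ?(ltW p0) ?nnegrE ?powR_ge0//.
  rewrite /S (bigD1 i)//= lerDl; apply: sumr_ge0 => j _; exact: powR_ge0.
suff H : \sum_i a i ^+ 2 <= (S `^ p^-1) ^+ 2.
  by apply: (le_trans (ler_wsqrtr H)); rewrite sqrtr_sqr ger0_norm ?powR_ge0.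
have -> : (S `^ p^-1) ^+ 2 = \sum_i `|a i| `^ p * (S `^ p^-1) `^ (2 - p).
  rewrite -mulr_suml -/S -powR_mulrn ?powR_ge0// -[in RHS]powRrM.
  have [->|Sn0] := eqVneq S 0; first by rewrite mul0r !powR0// invr_neq0// gt_eqF.
  rewrite -[X in X * _]powRr1// -powRD ?Sn0 ?implybT//.
  by rewrite -powRrM; congr (_ `^ _); field; rewrite gt_eqF.
apply: ler_sum => i _.
rewrite -real_normK ?num_real// -powR_mulrn// -[in leLHS](subrK p 2) addrC.
have [a0|an0] := eqVneq `|a i| 0.
  by rewrite a0 powR0 ?mulr_ge0 ?powR_ge0// gt_eqF//; lra.
rewrite powRD ?an0 ?implybT// ler_wpM2l ?powR_ge0//.
by apply: ge0_ler_powR; rewrite ?nnegrE ?powR_ge0// subr_ge0.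
Qed.

(** Used to solve for the expected gradient norm, which appears on both sides
    of the averaged inequality. *)
Lemma le_of_sqr_le (x a b c : R) : 0 <= a -> 0 <= b -> 0 <= c ->
  x ^+ 2 <= a + b * x + c -> x <= Num.sqrt a + b + Num.sqrt c.
Proof.
move=> a0 b0 c0 H; rewrite leNgt; apply/negP => xlt.
have := sqrtr_ge0 a; have := sqrtr_ge0 c.
move: H; rewrite -{1}(sqr_sqrtr a0) -{1}(sqr_sqrtr c0).
move: (Num.sqrt a) (Num.sqrt c) xlt => u v xlt H v0 u0.
nra.
Qed.

Lemma sqrtrD_le (a b : R) : 0 <= a -> 0 <= b ->
  Num.sqrt (a + b) <= Num.sqrt a + Num.sqrt b.
Proof.
move=> a0 b0; rewrite -[leRHS]ger0_norm ?addr_ge0 ?sqrtr_ge0//.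
rewrite -sqrtr_sqr; apply: ler_wsqrtr; rewrite sqrrD !sqr_sqrtr//.
by have := sqrtr_ge0 a; have := sqrtr_ge0 b; nra.
Qed.

(** A cheap triangle inequality: the factor 2, obtained from
    [(a + b)^2 <= 4 a^2 + 4 b^2], only affects the final constant. *)
Lemma sqrt_sum_sqrD_le (I : finType) (a b : I -> R) :
  Num.sqrt (\sum_i (a i + b i) ^+ 2) <=
  2 * (Num.sqrt (\sum_i a i ^+ 2) + Num.sqrt (\sum_i b i ^+ 2)).
Proof.
have a0 : 0 <= \sum_i a i ^+ 2 by apply: sumr_ge0 => i _; exact: sqr_ge0.
have b0 : 0 <= \sum_i b i ^+ 2 by apply: sumr_ge0 => i _; exact: sqr_ge0.
have -> : 2 * (Num.sqrt (\sum_i a i ^+ 2) + Num.sqrt (\sum_i b i ^+ 2)) =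
    Num.sqrt (2 ^+ 2 * \sum_i a i ^+ 2) + Num.sqrt (2 ^+ 2 * \sum_i b i ^+ 2).
  by rewrite !(sqrtrM _ (sqr_ge0 2)) sqrtr_sqr ger0_norm// mulrDr.
apply: (@le_trans _ _ (Num.sqrt (2 ^+ 2 * \sum_i a i ^+ 2 + 2 ^+ 2 * \sum_i b i ^+ 2))).
  rewrite -mulrDr -big_split/= mulr_sumr; apply/ler_wsqrtr/ler_sum => i _.
  by have := sqr_ge0 (a i - b i); nra.
by apply: sqrtrD_le; rewrite mulr_ge0.
Qed.

(** The empirical variance [sum_i (a_i - m)^2] around the mean [m] is
    nonnegative. *)
Lemma mean_le_sqrt_sum_sqr (n : nat) (a : 'I_n -> R) : (0 < n)%N ->
  n%:R^-1 * \sum_i a i <= Num.sqrt (\sum_i a i ^+ 2) / Num.sqrt n%:R.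
Proof.
move=> n0; have nR : 0 < n%:R :> R by rewrite ltr0n.
set m := _ * _; apply: (le_trans (ler_norm m)).
rewrite -sqrtrV// -sqrtrM; last by apply: sumr_ge0 => i _; exact: sqr_ge0.
rewrite -sqrtr_sqr; apply: ler_wsqrtr.
rewrite ler_pdivlMr//.
have : 0 <= \sum_i (a i - m) ^+ 2 by apply: sumr_ge0 => i _; exact: sqr_ge0.
have -> : \sum_i (a i - m) ^+ 2 =
    \sum_i a i ^+ 2 - 2 * m * (\sum_i a i) + m ^+ 2 * n%:R.
  have -> : m ^+ 2 * n%:R = \sum_(i < n) m ^+ 2.
    by rewrite sumr_const card_ord mulr_natr.
  rewrite mulr_sumr -sumrB -big_split/=.
  by apply: eq_bigr => i _; ring.
have -> : \sum_i a i = m * n%:R by rewrite /m mulrAC mulVf ?mul1r// gt_eqF.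
nra.
Qed.

(** Both square roots are at most [b], and
    [n = (sqrt (s + n) - sqrt s) (sqrt (s + n) + sqrt s)]. *)
Lemma sqrt_increment_le (s n b : R) : 0 <= s -> 0 <= n -> 0 < b ->
  Num.sqrt (s + n) <= b -> n / b <= 2 * (Num.sqrt (s + n) - Num.sqrt s).
Proof.
move=> s0 n0 b0 sb; rewrite ler_pdivrMr//.
have := sqrtr_ge0 s; have : Num.sqrt s <= Num.sqrt (s + n).
  by apply: ler_wsqrtr; lra.
have : n = Num.sqrt (s + n) ^+ 2 - Num.sqrt s ^+ 2.
  by rewrite !sqr_sqrtr ?addr_ge0//; ring.
move: (Num.sqrt (s + n)) (Num.sqrt s) sb => u v ub nE vu v0.
by rewrite nE; nra.
Qed.

(** The pathwise summation for AdaGrad-type weights [b t].  The induction keeps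
    the stronger bound with [M - h T.+1] in place of [M - m]: raising the
    weight from [b T] to [b T.+1] only enlarges that bound because [M - h] is
    nonnegative, and this replaces an explicit Abel summation.  The terms
    [n t / b t] telescope by [sqrt_increment_le]. *)
Lemma sum_correlation_le (D n h : nat -> R) (lambda c ell M m : R) (T : nat) :
  0 < lambda -> 0 <= c -> 0 <= ell ->
  (forall t, 0 <= n t) -> (forall t, m <= h t <= M) ->
  let v t := \sum_(1 <= s < t.+1) n s in
  let b t := lambda + Num.sqrt (v t) in
  (forall t, (0 < t)%N ->
     D t <= c * b t * (h t - h t.+1) + 2^-1 * ell * (n t / b t)) ->
  \sum_(1 <= t < T.+1) D t <= c * b T * (M - m) + ell * Num.sqrt (v T).
Proof.
move=> lambda0 c0 ell0 n0 hM v b HD.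
have v0 t : 0 <= v t by apply: sumr_ge0.
have vS t : v t.+1 = v t + n t.+1 by rewrite /v big_nat_recr.
have b0 t : 0 < b t by rewrite ltr_pwDl// sqrtr_ge0.
have bS t : b t <= b t.+1.
  by rewrite lerD2l; apply: ler_wsqrtr; rewrite vS lerDl.
apply: (@le_trans _ _ (c * b T * (M - h T.+1) + ell * Num.sqrt (v T))); last first.
  rewrite lerD2r ler_wpM2l//; first by rewrite mulr_ge0// ltW.
  by have /andP[? ?] := hM T.+1; lra.
elim: T => [|T IH].
  rewrite big_nil addr_ge0// mulr_ge0 ?sqrtr_ge0//.
    by rewrite mulr_ge0// ltW.
  by have /andP[? ?] := hM 1; lra.
rewrite big_nat_recr//=.
have {}HD := HD T.+1 isT.
have inc : n T.+1 / b T.+1 <= 2 * (Num.sqrt (v T.+1) - Num.sqrt (v T)).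
  rewrite vS; apply: sqrt_increment_le => //.
  by rewrite -vS /b lerDr ltW.
have e1 : 2^-1 * ell * (n T.+1 / b T.+1) <=
    ell * Num.sqrt (v T.+1) - ell * Num.sqrt (v T).
  apply: (le_trans (ler_wpM2l _ inc)); first by rewrite mulr_ge0// invr_ge0.
  by rewrite le_eqVlt; apply/orP; left; apply/eqP; field.
have e2 : c * b T * (M - h T.+1) <= c * b T.+1 * (M - h T.+1).
  rewrite ler_wpM2r//; first by have /andP[? ?] := hM T.+1; lra.
  by rewrite ler_wpM2l.
have -> : c * b T.+1 * (M - h T.+2) =
    c * b T.+1 * (M - h T.+1) + c * b T.+1 * (h T.+1 - h T.+2) by ring.
lra.
Qed.

End real_inequalities.

(** * Expectations of real random variables *)

Section real_expectation.
Context (R : realType) (disp : measure_display) (Omega : measurableType disp).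
Variable P : probability Omega R.
Implicit Types X Y : Omega -> R.

Lemma integrable_measurable X :
  P.-integrable setT (EFin \o X) -> measurable_fun setT X.
Proof. by move=> iX; apply/measurable_EFinP/(measurable_int P). Qed.

Lemma integrable_cst (c : R) : P.-integrable setT (EFin \o (fun=> c)).
Proof. exact: finite_measure_integrable_cst. Qed.

Lemma Rintegral_cst_probability (c : R) : \int[P]_w c = c.
Proof. by rewrite Rintegral_cst// [X in fine X]probability_setT mulr1. Qed.

Lemma integrable_scale (c : R) X :
  P.-integrable setT (EFin \o X) -> P.-integrable setT (EFin \o (fun w => c * X w)).
Proof. by move=> iX; exact: (integrableZl measurableT c iX). Qed.

Lemma integrable_add X Y :
  P.-integrable setT (EFin \o X) -> P.-integrable setT (EFin \o Y) ->
  P.-integrable setT (EFin \o (fun w => X w + Y w)).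
Proof. by move=> iX iY; exact: (integrableD measurableT iX iY). Qed.

Lemma integrable_big_sum (I : Type) (r : seq I) (X : I -> Omega -> R) :
  (forall i, P.-integrable setT (EFin \o X i)) ->
  P.-integrable setT (EFin \o (fun w => \sum_(i <- r) X i w)).
Proof.
move=> iX; elim: r => [|i r IH].
  by under eq_fun do rewrite big_nil; exact: integrable_cst.
by under eq_fun do rewrite big_cons; exact: integrable_add.
Qed.

Lemma Rintegral_big_sum (I : Type) (r : seq I) (X : I -> Omega -> R) :
  (forall i, P.-integrable setT (EFin \o X i)) ->
  \int[P]_w (\sum_(i <- r) X i w) = \sum_(i <- r) \int[P]_w X i w.
Proof.
move=> iX; elim: r => [|i r IH].
  under eq_Rintegral do rewrite big_nil.
  by rewrite big_nil Rintegral_cst_probability.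
under eq_Rintegral do rewrite big_cons.
by rewrite RintegralD ?big_cons ?IH//; exact: integrable_big_sum.
Qed.

Lemma integrable_dominated X Y : measurable_fun setT X ->
  (forall w, `|X w| <= Y w) -> P.-integrable setT (EFin \o Y) ->
  P.-integrable setT (EFin \o X).
Proof.
move=> mX XY iY; apply: le_integrable iY => //; first exact/measurable_EFinP.
move=> w _ /=; rewrite lee_fin; exact: le_trans (XY w) (ler_norm _).
Qed.

Lemma integrable_bounded_mul (M : R) X Y : measurable_fun setT Y ->
  (forall w, `|Y w| <= M) -> P.-integrable setT (EFin \o X) ->
  P.-integrable setT (EFin \o (fun w => Y w * X w)).
Proof.
move=> mY YM iX; have mX := integrable_measurable iX.
apply: (@integrable_dominated _ (fun w => M * `|X w|)).
- exact: measurable_funM.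
- by move=> w; rewrite normrM ler_wpM2r.
- by apply: integrable_scale; exact: integrable_norm.
Qed.

Lemma le_expectation X Y :
  P.-integrable setT (EFin \o X) -> P.-integrable setT (EFin \o Y) ->
  (forall w, X w <= Y w) -> \int[P]_w X w <= \int[P]_w Y w.
Proof. by move=> iX iY XY; apply: le_Rintegral. Qed.

Lemma Rintegral_indic_mul (A : set Omega) X :
  \int[P]_w (\1_A w * X w) = \int[P]_(w in A) X w.
Proof.
rewrite [RHS]Rintegral_mkcond; apply: eq_Rintegral => w _.
by rewrite patchE indicE; case: (w \in A); rewrite ?mul1r ?mul0r.
Qed.

(** The sum counts the steps of height [e] that lie below [u], so it is [u]
    rounded down to a multiple of [e]; [n] steps suffice below [n.+1 * e]. *)
Lemma staircase_approx (e u : R) (n : nat) : 0 < e -> 0 <= u -> u < n.+1%:R * e ->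
  `|u - \sum_(k < n) e * (k.+1%:R * e <= u)%R%:R| <= e.
Proof.
move=> e0 u0; elim: n => [|n IH] un.
  by rewrite big_ord0 subr0 ger0_norm//; lra.
have [un'|nu] := ltP u (n.+1%:R * e).
  have top : (n.+1%:R * e <= u)%R = false by rewrite leNgt un'.
  by rewrite big_ord_recr/= top mulr0 addr0; exact: IH.
rewrite (eq_bigr (fun=> e)) => [|k _].
  rewrite sumr_const card_ord ger0_norm -mulr_natl; first last.
    by lra.
  by move: un; rewrite -[n.+2%:R]natr1; lra.
rewrite (le_trans _ nu) ?mulr1// ler_wpM2r ?ler_nat//; exact: ltW.
Qed.

(** If [X] integrates to 0 on every upper level set of the bounded function
    [Y], it is orthogonal to [Y]: up to an error [e], [Y + M] is a finite
    combination of indicators of such sets. *)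
Lemma Rintegral_mul_eq0 (M : R) X Y :
  P.-integrable setT (EFin \o X) -> (forall w, `|Y w| <= M) ->
  measurable_fun setT Y ->
  (forall c, \int[P]_(w in [set w | c <= Y w]) X w = 0) ->
  \int[P]_w (Y w * X w) = 0.
Proof.
move=> iX YM mY X0.
have mA c : measurable [set w | c <= Y w].
  by rewrite -preimage_itvcy -[X in measurable X]setTI; exact: mY.
(* The level set at [- M] is the whole space. *)
have XT : \int[P]_w X w = 0.
  rewrite -(X0 (- M)); congr (Rintegral _ _ _); apply/esym/seteqP; split=> // w _ /=.
  by have := YM w; rewrite ler_norml => /andP[].
have iN : P.-integrable setT (EFin \o (fun w => `|X w|)) by exact: integrable_norm.
have iYX : P.-integrable setT (EFin \o (fun w => Y w * X w)).
  exact: integrable_bounded_mul YM iX.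
apply/eqP; rewrite -normr_le0; apply/ler_addgt0Pl => e0 e0_gt0; rewrite addr0.
have K1 : 0 < 1 + \int[P]_w `|X w| by rewrite ltr_pwDl// Rintegral_ge0.
pose e := e0 / (1 + \int[P]_w `|X w|).
have e_gt0 : 0 < e by rewrite divr_gt0.
suff : `|\int[P]_w (Y w * X w)| <= e * \int[P]_w `|X w|.
  move=> /le_trans; apply; rewrite /e mulrAC ler_pdivrMr//.
  by rewrite ler_wpM2l ?(ltW e0_gt0)// lerDr.
pose n := Num.bound (2 * M / e).
pose A (k : 'I_n) := [set w | k.+1%:R * e - M <= Y w].
(* [Z] is the staircase approximation of [Y], multiplied by [X]. *)
pose Z w := \sum_(k < n) e * (\1_(A k) w * X w) - M * X w.
have iA k : P.-integrable setT (EFin \o (fun w => \1_(A k) w * X w)).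
  apply: (@integrable_bounded_mul 1) => // [|w].
    by apply: measurable_indic; exact: mA.
  by rewrite indicE; case: (_ \in _); rewrite ?normr1 ?normr0.
have iS : P.-integrable setT
    (EFin \o (fun w => \sum_(k < n) e * (\1_(A k) w * X w))).
  by apply: integrable_big_sum => k; exact: integrable_scale.
have iMX := integrable_scale M iX.
have iZ : P.-integrable setT (EFin \o Z).
  apply: integrable_add iS _; under eq_fun do rewrite -mulNr.
  exact: integrable_scale.
have Z0 : \int[P]_w Z w = 0.
  rewrite RintegralB// RintegralZl// XT mulr0 subr0.
  rewrite Rintegral_big_sum => [|k]; last exact: integrable_scale.
  apply: big1 => k _; rewrite RintegralZl// Rintegral_indic_mul X0.
  by rewrite mulr0.
have -> : \int[P]_w (Y w * X w) = \int[P]_w (Y w * X w - Z w).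
  by rewrite RintegralB// Z0 subr0.
have iYZ : P.-integrable setT (EFin \o (fun w => Y w * X w - Z w)).
  exact: (integrableB measurableT iYX iZ).
rewrite (le_trans (le_normr_Rintegral _ iYZ))// -RintegralZl//.
apply: le_expectation; [exact: integrable_norm|exact: integrable_scale|].
move=> w; rewrite /Z.
under eq_bigr do rewrite mulrA.
rewrite -mulr_suml opprB addrA -mulrDl -mulrBl normrM ler_wpM2r//.
have -> : \sum_(k < n) e * \1_(A k) w =
    \sum_(k < n) e * (k.+1%:R * e <= Y w + M)%R%:R.
  apply: eq_bigr => k _; rewrite indicE; congr (_ * (nat_of_bool _)%:R).
  by rewrite -lerBlDr; apply/idP/idP; rewrite inE.
have := YM w; rewrite ler_norml => /andP[Y1 Y2].
apply: staircase_approx => //; first by lra.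
have : 2 * M / e < n%:R.
  by apply: archi_boundP; rewrite divr_ge0 ?(ltW e_gt0)//; lra.
by rewrite ltr_pdivrMr// -natr1 mulrDl mul1r; lra.
Qed.

(** The tangent at 1 of a concave power; Young's inequality with second factor
    equal to 1. *)
Lemma powR_le_tangent (u r : R) : 0 <= u -> 0 < r -> r < 1 ->
  u `^ r <= 1 - r + r * u.
Proof.
move=> u0 r0 r1.
have r1' : 0 < 1 - r by lra.
have := @conjugate_powR R (u `^ r) 1 r^-1 (1 - r)^-1 (powR_ge0 _ _) ler01.
rewrite !invr_gt0 !invrK => /(_ r0 r1').
rewrite -powRrM divff ?gt_eqF// powRr1// powR1 mulr1 mul1r.
by rewrite addrC subrK => /(_ erefl) H; rewrite mulrC; lra.
Qed.

Lemma integrable_powR (r : R) X : 0 < r -> r < 1 -> (forall w, 0 <= X w) ->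
  P.-integrable setT (EFin \o X) ->
  P.-integrable setT (EFin \o (fun w => X w `^ r)).
Proof.
move=> r0 r1 X0 iX.
apply: (@integrable_dominated _ (fun w => 1 - r + r * X w)).
- exact: measurableT_comp (measurable_powR _) (integrable_measurable iX).
- by move=> w; rewrite ger0_norm ?powR_ge0// powR_le_tangent.
- by apply: integrable_add; [exact: integrable_cst|exact: integrable_scale].
Qed.

(** Jensen's inequality for a concave power.  Integrating the tangent at [b]
    gives the bound [b `^ r] for each positive [b >= c]; as [c] may vanish,
    the proof takes [b] slightly larger than [c] and lets it decrease to [c]. *)
Lemma Rintegral_powR_le (r c : R) X : 0 < r -> r < 1 -> (forall w, 0 <= X w) ->
  P.-integrable setT (EFin \o X) -> \int[P]_w X w <= c ->
  \int[P]_w (X w `^ r) <= c `^ r.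
Proof.
move=> r0 r1 X0 iX Xc.
have c0 : 0 <= c by apply: le_trans Xc; exact: Rintegral_ge0.
apply/ler_addgt0Pr => e e0.
pose b := (c `^ r + e) `^ r^-1.
have ce0 : 0 < c `^ r + e by rewrite ltr_wpDl// powR_ge0.
have b0 : 0 < b by exact: powR_gt0.
have br : b `^ r = c `^ r + e.
  by rewrite /b -powRrM mulVf ?gt_eqF// powRr1// ltW.
have cb : c <= b.
  rewrite -[leLHS]powRr1// -(divff (lt0r_neq0 r0)) powRrM.
  by apply: ge0_ler_powR; rewrite ?invr_ge0 ?nnegrE ?powR_ge0// ?ltW// ltrDl.
rewrite -br.
have iT : P.-integrable setT (EFin \o (fun w => 1 - r + r / b * X w)).
  by apply: integrable_add; [exact: integrable_cst|exact: integrable_scale].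
apply: (@le_trans _ _ (\int[P]_w (b `^ r * (1 - r + r / b * X w)))).
  apply: le_expectation; [exact: integrable_powR|exact: integrable_scale|].
  move=> w.
  have [u u0 ->] : exists2 u, 0 <= u & X w = b * u.
    exists (X w / b); first by rewrite divr_ge0// ltW.
    by rewrite mulrCA divff ?mulr1// gt_eqF.
  rewrite (powRM _ (ltW b0) u0) ler_wpM2l ?powR_ge0//.
  rewrite [r / b * _]mulrA divfK ?gt_eqF//.
  exact: powR_le_tangent.
rewrite RintegralZl// ler_piMr ?powR_ge0//.
rewrite RintegralD//; [|exact: integrable_cst|exact: integrable_scale].
rewrite Rintegral_cst_probability RintegralZl//.
rewrite -mulrA -lerBrDl opprB addrC subrK -[leRHS]mulr1 ler_wpM2l ?(ltW r0)//.
by rewrite mulrC ler_pdivrMr// mul1r (le_trans Xc).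
Qed.

(** The variance of [X] is nonnegative. *)
Lemma sqr_Rintegral_le X : P.-integrable setT (EFin \o X) ->
  P.-integrable setT (EFin \o (fun w => X w ^+ 2)) ->
  (\int[P]_w X w) ^+ 2 <= \int[P]_w (X w ^+ 2).
Proof.
move=> iX iX2; set m := \int[P]_w X w.
have : 0 <= \int[P]_w ((X w - m) ^+ 2) by apply: Rintegral_ge0 => w _; exact: sqr_ge0.
have -> : \int[P]_w ((X w - m) ^+ 2) =
    \int[P]_w (X w ^+ 2 + ((- 2 * m) * X w + m ^+ 2)).
  by apply: eq_Rintegral => w _; ring.
have iL := integrable_scale (- 2 * m) iX.
have iC := integrable_cst (m ^+ 2).
rewrite RintegralD//; last exact: integrable_add.
by rewrite RintegralD// RintegralZl// -/m Rintegral_cst_probability; lra.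
Qed.

Lemma measurable_fun_sqrt (X : Omega -> R) : measurable_fun setT X ->
  measurable_fun setT (fun w => Num.sqrt (X w)).
Proof.
apply: measurableT_comp; apply: continuous_measurable_fun; exact: sqrt_continuous.
Qed.

(** Truncating [Y] at [c] changes it only on a negligible set, and makes the
    bound hold everywhere. *)
Lemma Rintegral_le_ae (c : R) (Y : Omega -> R) :
  P.-integrable setT (EFin \o Y) -> {ae P, forall w, Y w <= c} ->
  \int[P]_w Y w <= c.
Proof.
move=> iY Yc; have mY := integrable_measurable iY.
have mm : measurable_fun setT (fun w => Num.min (Y w) c).
  exact: measurable_minr.
have im : P.-integrable setT (EFin \o (fun w => Num.min (Y w) c)).
  apply: (@integrable_dominated _ (fun w => `|Y w| + `|c|)) => //.
    by move=> w; rewrite /Num.min; case: ifP => _; rewrite ?lerDl ?lerDr.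
  by apply: integrable_add; [exact: integrable_norm|exact: integrable_cst].
have -> : \int[P]_w Y w = \int[P]_w Num.min (Y w) c.
  congr fine; apply: ae_eq_integral => //; try exact/measurable_EFinP.
  by apply: filterS Yc => w Yw _; rewrite min_l.
rewrite -[leRHS](Rintegral_cst_probability _).
by apply: le_expectation => // [|w]; [exact: integrable_cst|rewrite ge_min lexx orbT].
Qed.

End real_expectation.

(** * Conditional expectations *)

Section conditional.
Context (R : realType) (disp : measure_display) (Omega : measurableType disp).
Variable P : probability Omega R.

Section one_conditional_expectation.
Variables (F : set (set Omega)) (X Y : Omega -> R).
Hypothesis condXY : is_cond_expectation P F X Y.

Lemma Rintegral_cond_expectation : F setT -> \int[P]_w Y w = \int[P]_w X w.
Proof. by case: condXY => _ _ _ eqXY FT; congr fine; exact: eqXY. Qed.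

(** The error of a conditional expectation is orthogonal to the conditional
    expectation itself: it integrates to 0 over the level sets of [Y], which
    belong to [F]. *)
Lemma cond_expectation_orthogonal (M : R) : (forall w, `|Y w| <= M) ->
  \int[P]_w (Y w * (X w - Y w)) = 0.
Proof.
case: condXY => iX iY FY eqXY YM.
have mY := integrable_measurable iY.
apply: (Rintegral_mul_eq0 _ YM mY) => [|c].
  exact: (integrableB measurableT iX iY).
have Fc : F [set w | c <= Y w].
  by rewrite -preimage_itvcy; apply: FY; exact: measurable_itv.
have mc : measurable [set w | c <= Y w].
  by rewrite -preimage_itvcy -[X in measurable X]setTI; exact: mY.
rewrite RintegralB//; [|exact: integrableS iX|exact: integrableS iY].
by rewrite /Rintegral eqXY// subrr.
Qed.

End one_conditional_expectation.

Lemma natural_filtration_setT (d : nat) (g : nat -> Omega -> 'rV[R]_d) (t : nat) :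
  natural_filtration g t setT.
Proof.
have [s0 sC _] := smallest_sigma_algebra setT [set A | exists s (i : 'I_d) (B : set R),
         [/\ (1 <= s <= t)%N, measurable B & A = (fun w => g s w 0 i) @^-1` B] ].
by have := sC _ s0; rewrite setD0.
Qed.

End conditional.

(** * From correlations to gradient norms *)

Section correlation_to_gradient.
Context (R : realType) (disp : measure_display) (Omega : measurableType disp).
Variable P : probability Omega R.

(** The step from correlations to gradient norms, for arbitrary random
    variables [X j] (stochastic gradient coordinates) whose noise [X j - G j]
    is orthogonal to [G j] (gradient coordinates); the index [j] runs over all pairs of a time and a coordinate, so
    that the l^2 to l^p comparison is made once for the whole trajectory.  The
    noise enters twice: in the correlations, where orthogonality removes it,
    and in the norm of [X], where its [p]-th moments control it. *)
Lemma expectation_gradient_le (J : finType) (p a B M : R) (s : J -> R)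
    (G X : J -> Omega -> R) :
  1 < p -> p <= 2 -> 0 <= a -> 0 <= B ->
  (forall j, measurable_fun setT (G j)) -> (forall j w, `|G j w| <= M) ->
  (forall j, P.-integrable setT (EFin \o X j)) ->
  (forall j, \int[P]_w (G j w * (X j w - G j w)) = 0) ->
  (forall j, P.-integrable setT (EFin \o (fun w => `|X j w - G j w| `^ p))) ->
  (forall j, \int[P]_w (`|X j w - G j w| `^ p) <= s j `^ p) ->
  (forall w, \sum_j G j w * X j w <= a + B * Num.sqrt (\sum_j X j w ^+ 2)) ->
  P.-integrable setT (EFin \o (fun w => Num.sqrt (\sum_j G j w ^+ 2))) /\
  \int[P]_w Num.sqrt (\sum_j G j w ^+ 2) <=
    Num.sqrt a + 2 * B + Num.sqrt (2 * B * (\sum_j s j `^ p) `^ p^-1).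
Proof.
move=> p1 p2 a0 B0 mG GM iX orth ixi xis HGX.
have p0 : 0 < p by lra.
pose Z w := Num.sqrt (\sum_j G j w ^+ 2).
pose S w := \sum_j `|X j w - G j w| `^ p.
have sumG_ge0 w : 0 <= \sum_j G j w ^+ 2 by apply: sumr_ge0 => j _; exact: sqr_ge0.
have Z2 w : Z w ^+ 2 = \sum_j G j w ^+ 2 by rewrite sqr_sqrtr.
have Z0 w : 0 <= Z w by exact: sqrtr_ge0.
have S0 w : 0 <= S w by apply: sumr_ge0 => j _; exact: powR_ge0.
have iG j : P.-integrable setT (EFin \o G j).
  exact: integrable_dominated (mG j) (GM j) (integrable_cst P M).
have iG2 j : P.-integrable setT (EFin \o (fun w => G j w ^+ 2)).
  exact: (integrable_bounded_mul (mG j) (GM j) (iG j)).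
have iZ2 : P.-integrable setT (EFin \o (fun w => Z w ^+ 2)).
  by under eq_fun do rewrite /= Z2; exact: integrable_big_sum.
have iZ : P.-integrable setT (EFin \o Z).
  apply: (@integrable_dominated _ _ _ _ _ (fun w => 1 + Z w ^+ 2)).
  - apply: measurable_fun_sqrt; apply: measurable_sum => j.
    exact: measurable_funX.
  - by move=> w; rewrite ger0_norm//; have := sqr_ge0 (Z w - 1); nra.
  - by apply: integrable_add => //; exact: integrable_cst.
split=> //.
have iS : P.-integrable setT (EFin \o S) by exact: integrable_big_sum.
have p'0 : 0 < p^-1 by rewrite invr_gt0.
have p'1 : p^-1 < 1 by rewrite invf_lt1.
have iW := integrable_powR p'0 p'1 S0 iS.
have iD j : P.-integrable setT (EFin \o (fun w => X j w - G j w)).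
  exact: (integrableB measurableT (iX j) (iG j)).
have iN j : P.-integrable setT (EFin \o (fun w => G j w * (X j w - G j w))).
  exact: integrable_bounded_mul (mG j) (GM j) (iD j).
have iNs := integrable_big_sum (index_enum J) iN.
have W_le : \int[P]_w (S w `^ p^-1) <= (\sum_j s j `^ p) `^ p^-1.
  apply: Rintegral_powR_le => //.
  by rewrite Rintegral_big_sum//; apply: ler_sum.
have path w : Z w ^+ 2 + \sum_j G j w * (X j w - G j w) <=
    a + (2 * B * Z w + 2 * B * S w `^ p^-1).
  have -> : Z w ^+ 2 + \sum_j G j w * (X j w - G j w) = \sum_j G j w * X j w.
    by rewrite Z2 -big_split/=; apply: eq_bigr => j _; ring.
  apply: (le_trans (HGX w)); rewrite lerD2l.
  have -> : 2 * B * Z w + 2 * B * S w `^ p^-1 =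
      B * (2 * (Z w + S w `^ p^-1)) by ring.
  rewrite ler_wpM2l//.
  have := sqrt_sum_sqrD_le (G ^~ w) (fun j => X j w - G j w).
  have -> : \sum_j (G j w + (X j w - G j w)) ^+ 2 = \sum_j X j w ^+ 2.
    by apply: eq_bigr => j _; congr (_ ^+ 2); ring.
  move=> /le_trans; apply; rewrite ler_wpM2l// lerD2l.
  exact: sqrt_sum_sqr_le_lp.
have i2Z := integrable_scale (2 * B) iZ.
have i2W := integrable_scale (2 * B) iW.
have ZW := integrable_add i2Z i2W.
have := le_expectation (integrable_add iZ2 iNs)
  (integrable_add (integrable_cst P a) ZW) path.
rewrite !RintegralD//; last exact: integrable_cst.
rewrite Rintegral_big_sum// [X in _ + X]big1 => [|j _]; last exact: orth.
rewrite addr0 Rintegral_cst_probability !RintegralZl//.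
have := sqr_Rintegral_le iZ iZ2.
move: (\int[P]_w Z w) (\int[P]_w (Z w ^+ 2)) => m m2 m_le m2_le.
have c0 : 0 <= (\sum_j s j `^ p) `^ p^-1 by exact: powR_ge0.
apply: le_of_sqr_le; rewrite ?mulr_ge0//.
apply: (le_trans m_le); apply: (le_trans m2_le).
by rewrite addrA lerD2l ler_wpM2l// mulr_ge0.
Qed.

End correlation_to_gradient.

(** * Bounded smooth functions along the iterates *)
Section smooth_bounded.
Context (R : realType) (d : nat) (f : 'rV[R]_d -> R) (L : 'rV[R]_d).
Hypothesis smooth : forall y z,
  `|f y - f z - dotprod (grad f z) (y - z)| <= 2^-1 * sqwnorm L (y - z).

Lemma sqr_l2norm (v : 'rV[R]_d) : l2norm v ^+ 2 = \sum_i v 0 i ^+ 2.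
Proof. by rewrite sqr_sqrtr//; apply: sumr_ge0 => i _; exact: sqr_ge0. Qed.

Lemma norm_coord_le_linfnorm (v : 'rV[R]_d) i : `|v 0 i| <= linfnorm v.
Proof.
rewrite /linfnorm [leRHS]mx_normrE.
exact: (le_bigmax _ (fun ij : 'I_1 * 'I_d => `|v ij.1 ij.2|) (0, i)).
Qed.

Lemma sqwnorm_le (v : 'rV[R]_d) : sqwnorm L v <= linfnorm L * l2norm v ^+ 2.
Proof.
rewrite sqr_l2norm mulr_sumr; apply: ler_sum => i _.
rewrite ler_wpM2r ?sqr_ge0//.
exact: le_trans (ler_norm _) (norm_coord_le_linfnorm _ _).
Qed.

Lemma l2normZ_sqr (k : R) (v : 'rV[R]_d) : l2norm (k *: v) ^+ 2 = k ^+ 2 * l2norm v ^+ 2.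
Proof.
rewrite !sqr_l2norm mulr_sumr; apply: eq_bigr => i _.
by rewrite mxE exprMn.
Qed.

Lemma dotprodZr (k : R) (u v : 'rV[R]_d) : dotprod u (k *: v) = k * dotprod u v.
Proof.
by rewrite /dotprod mulr_sumr; apply: eq_bigr => i _; rewrite mxE mulrCA.
Qed.

(** Moving by a unit vector changes [f] by at most [M - m], and this change is
    the partial derivative up to [L i / 2]. *)
Lemma grad_bounded (m M : R) : (forall y, m <= f y <= M) ->
  forall z i, `|grad f z 0 i| <= M - m + linfnorm L.
Proof.
move=> fmM z i.
have e2 : l2norm (delta_mx 0 i : 'rV[R]_d) ^+ 2 = 1.
  rewrite sqr_l2norm (bigD1 i)//= big1 => [|j ji]; rewrite mxE !eqxx/=.
    by rewrite expr1n addr0.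
  by rewrite (negbTE ji) expr0n.
have := smooth (z + delta_mx 0 i) z.
rewrite [z + _ - z]addrC addKr.
have -> : dotprod (grad f z) (delta_mx 0 i) = grad f z 0 i.
  rewrite /dotprod (bigD1 i)//= big1 => [|j ji]; rewrite [delta_mx _ _ _ _]mxE eqxx/=.
    by rewrite eqxx mulr1 addr0.
  by rewrite (negbTE ji) mulr0.
have := sqwnorm_le (delta_mx 0 i); rewrite e2 mulr1.
have := norm_coord_le_linfnorm L i; have := normr_ge0 (L 0 i).
have /andP[] := fmM z; have /andP[] := fmM (z + delta_mx 0 i).
rewrite !ler_norml => ? ? ? ? ? ? ? /andP[? ?]; apply/andP; split; lra.
Qed.

(** The descent inequality for a step of length [gamma / b], multiplied by
    [b / gamma] so that the correlation carries no random weight. *)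
Lemma descent_step (gamma b : R) (z g : 'rV[R]_d) : 0 < gamma -> 0 < b ->
  dotprod (grad f z) g <= gamma^-1 * b * (f z - f (z - (gamma / b) *: g))
    + 2^-1 * (gamma * linfnorm L) * (l2norm g ^+ 2 / b).
Proof.
move=> gamma0 b0; have := smooth (z - (gamma / b) *: g) z.
rewrite [z - _ - z]addrC addKr -scaleNr dotprodZr.
have := sqwnorm_le (- (gamma / b) *: g); rewrite l2normZ_sqr sqrrN.
rewrite ler_norml => H /andP[_ {}].
move: (dotprod _ _) (f _) (f z) H => D f1 f0 H K.
have {H K} : gamma / b * D <=
    f0 - f1 + 2^-1 * (linfnorm L * ((gamma / b) ^+ 2 * l2norm g ^+ 2)).
  lra.
have k0 : 0 <= gamma^-1 * b by rewrite mulr_ge0 ?invr_ge0// ltW.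
move=> /(ler_wpM2l k0).
have -> : gamma^-1 * b * (gamma / b * D) = D by field; rewrite !gt_eqF.
move=> /le_trans; apply; rewrite le_eqVlt; apply/orP; left; apply/eqP; field.
by rewrite !gt_eqF.
Qed.

Lemma adagrad_correlation_le (Omega : Type) (x1 : 'rV[R]_d) (gamma lambda m M : R)
    (g : nat -> Omega -> 'rV[R]_d) (T : nat) (w : Omega) :
  (forall y, m <= f y <= M) -> 0 < gamma -> 0 < lambda ->
  \sum_(1 <= t < T.+1) dotprod (grad f (adagrad_x x1 gamma lambda g t w)) (g t w) <=
    lambda * (M - m) / gamma
    + ((M - m) / gamma + gamma * linfnorm L) * Num.sqrt (adagrad_v g T w).
Proof.
move=> fmM gamma0 lambda0.
have -> : lambda * (M - m) / gamma
    + ((M - m) / gamma + gamma * linfnorm L) * Num.sqrt (adagrad_v g T w) =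
  gamma^-1 * (lambda + Num.sqrt (adagrad_v g T w)) * (M - m)
  + gamma * linfnorm L * Num.sqrt (adagrad_v g T w) by ring.
apply: (sum_correlation_le (n := fun t => l2norm (g t w) ^+ 2)
  (h := fun t => f (adagrad_x x1 gamma lambda g t w))) => //.
- by rewrite invr_ge0 ltW.
- by rewrite mulr_ge0 ?(ltW gamma0)// normr_ge0.
- by move=> t; exact: sqr_ge0.
(* The iterate at time [t.+2] unfolds to one step from time [t.+1], since
   only times 0 and 1 carry the initial point. *)
case=> // t _ /=.
apply: descent_step => //.
by rewrite ltr_pwDl// sqrtr_ge0.
Qed.

End smooth_bounded.

(** * Convergence rate *)

Lemma lpnorm_horizon (R : realType) (d T : nat) (p : R) (sigma : 'rV[R]_d) :
  (forall i, 0 <= sigma 0 i) ->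
  (\sum_(j : 'I_T * 'I_d) sigma 0 j.2 `^ p) `^ p^-1 =
    T%:R `^ p^-1 * lpnorm p sigma.
Proof.
move=> sigma0.
rewrite -(pair_bigA _ (fun (t : 'I_T) (i : 'I_d) => sigma 0 i `^ p))/=.
set s := \sum_(i < d) _; have -> : \sum_(t < T) s = T%:R * s.
  by rewrite sumr_const card_ord mulr_natl.
have s0 : 0 <= s by apply: sumr_ge0 => i _; exact: powR_ge0.
rewrite (powRM _ (ler0n R T) s0).
congr (_ * _ `^ _); apply: eq_bigr => i _.
by rewrite ger0_norm.
Qed.

(** The exponents combine as [1 / (2 p) - 1 / 2 = - (p - 1) / (2 p)]. *)
Lemma sqrt_horizon_rate (R : realType) (T : nat) (p : R) : (0 < T)%N -> 0 < p ->
  Num.sqrt (T%:R `^ p^-1) / Num.sqrt T%:R = (T%:R `^ ((p - 1) / (2 * p)))^-1 :> R.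
Proof.
move=> T0 p0; have TR : 0 < T%:R :> R by rewrite ltr0n.
rewrite -!powR12_sqrt ?powR_ge0 ?ler0n// -powRrM -!powRN.
rewrite -powRD; last by rewrite (gt_eqF TR) implybT.
congr (_ `^ _); field; exact: lt0r_neq0.
Qed.

Theorem theorem4p2 (R : realType) :
  exists C : R, 0 < C /\
  forall (d : nat) (f : 'rV[R]_d -> R) (L : 'rV[R]_d)
    (disp : measure_display) (Omega : measurableType disp)
    (P : probability Omega R) (g : nat -> Omega -> 'rV[R]_d)
    (p : R) (sigma : 'rV[R]_d) (x1 : 'rV[R]_d) (gamma lambda : R) (T : nat),
  let x := adagrad_x x1 gamma lambda g in
  let F := natural_filtration g in
  let xi := fun (t : nat) (i : 'I_d) (w : Omega) =>
              g t w 0 i - grad f (x t w) 0 i in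
  let Delta := sup (range f) - inf (range f) in
  let A := Num.sqrt (lambda * Delta / gamma) + Delta / gamma
           + gamma * linfnorm L in
  let B := Delta / gamma + gamma * linfnorm L in
  (0 < d)%N ->
  (forall y, differentiable f y) ->
  has_lbound (range f) ->
  has_ubound (range f) ->
  (forall i, 0 < L 0 i) ->
  (forall y z, `|f y - f z - dotprod (grad f z) (y - z)|
                 <= 2^-1 * sqwnorm L (y - z)) ->
  (forall t i, (0 < t)%N -> measurable_fun setT (fun w => g t w 0 i)) ->
  (forall t i, (0 < t)%N ->
     is_cond_expectation P (F t.-1)
       (fun w => g t w 0 i) (fun w => grad f (x t w) 0 i)) ->
  1 < p -> p <= 2 ->
  (forall i, 0 <= sigma 0 i) ->
  (forall t i, (0 < t)%N ->
     exists Y : Omega -> R,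
       is_cond_expectation P (F t.-1) (fun w => `|xi t i w| `^ p) Y /\
       {ae P, forall w, Y w <= sigma 0 i `^ p}) ->
  0 < gamma -> 0 < lambda -> (0 < T)%N ->
  ('E_P[fun w => ((T%:R)^-1 * \sum_(1 <= t < T.+1) l2norm (grad f (x t w)))%R]
    <= (C * (A / Num.sqrt T%:R
             + Num.sqrt (B * lpnorm p sigma)
               / T%:R `^ ((p - 1) / (2 * p))))%:E)%E.
Proof.
exists 2; split => // d f L disp Omega P g p sigma x1 gamma lambda T.
move=> x F xi Delta A B _ _ flb fub _ smooth _ gcond p1 p2 sigma0 xicond.
move=> gamma0 lambda0 T0.
have p0 : 0 < p by exact: lt_trans p1.
have fb y : inf (range f) <= f y <= sup (range f).
  by apply/andP; split; [apply: ge_inf|apply: ub_le_sup] => //; exists y.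
have Delta0 : 0 <= Delta by rewrite subr_ge0; have /andP[] := fb 0; exact: le_trans.
have B0 : 0 <= B.
  by rewrite addr_ge0 ?divr_ge0 ?mulr_ge0 ?(ltW gamma0)// normr_ge0.
(* Position [t < T] of the index stands for time [t.+1]. *)
pose G (j : 'I_T * 'I_d) w := grad f (x j.1.+1 w) 0 j.2.
pose X (j : 'I_T * 'I_d) w := g j.1.+1 w 0 j.2.
have gc (j : 'I_T * 'I_d) : is_cond_expectation P (F j.1) (X j) (G j).
  exact: (gcond j.1.+1 j.2 isT).
have xc (j : 'I_T * 'I_d) :
    P.-integrable setT (EFin \o (fun w => `|X j w - G j w| `^ p)) /\
    \int[P]_w (`|X j w - G j w| `^ p) <= sigma 0 j.2 `^ p.
  have [Y [Yc Ys]] := xicond j.1.+1 j.2 isT.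
  have [iX iY _ _] := Yc; split => //.
  rewrite -(Rintegral_cond_expectation Yc); last exact: natural_filtration_setT.
  exact: Rintegral_le_ae.
have GM j w : `|G j w| <= Delta + linfnorm L by exact: (grad_bounded smooth fb).
have sumE (h : nat -> R) : \sum_(1 <= t < T.+1) h t = \sum_(t < T) h t.+1.
  by rewrite big_add1 big_mkord.
have vE w : adagrad_v g T w = \sum_j X j w ^+ 2.
  rewrite /adagrad_v sumE -(pair_bigA _ (fun (t : 'I_T) i => g t.+1 w 0 i ^+ 2))/=.
  by apply: eq_bigr => t _; rewrite sqr_l2norm.
have GXE w : \sum_j G j w * X j w =
    \sum_(1 <= t < T.+1) dotprod (grad f (x t w)) (g t w).
  by rewrite sumE -(pair_bigA _
    (fun (t : 'I_T) i => grad f (x t.+1 w) 0 i * g t.+1 w 0 i)).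
have ZE w : \sum_j G j w ^+ 2 = \sum_(t < T) l2norm (grad f (x t.+1 w)) ^+ 2.
  rewrite -(pair_bigA _ (fun (t : 'I_T) i => grad f (x t.+1 w) 0 i ^+ 2))/=.
  by apply: eq_bigr => t _; rewrite sqr_l2norm.
have mG j : measurable_fun setT (G j).
  by have [_ iG _ _] := gc j; exact: integrable_measurable iG.
have [|||iZ EZ] := @expectation_gradient_le R disp Omega P _ p
    (lambda * Delta / gamma) B (Delta + linfnorm L) (fun j => sigma 0 j.2) G X p1 p2
    _ B0 mG GM _ (fun j => cond_expectation_orthogonal (gc j) (GM j))
    (fun j => (xc j).1) (fun j => (xc j).2).
- by rewrite divr_ge0 ?mulr_ge0// ltW.
- by move=> j; have [] := gc j.
- by move=> w; rewrite -vE GXE; exact: adagrad_correlation_le.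
pose N w := T%:R^-1 * \sum_(1 <= t < T.+1) l2norm (grad f (x t w)).
have NZ w : N w <= (Num.sqrt T%:R)^-1 * Num.sqrt (\sum_j G j w ^+ 2).
  by rewrite /N sumE ZE mulrC [leRHS]mulrC mulrC; exact: mean_le_sqrt_sum_sqr.
have iZT := integrable_scale (Num.sqrt T%:R)^-1 iZ.
have N0 w : 0 <= N w.
  by rewrite mulr_ge0 ?invr_ge0// sumr_ge0// => t _; exact: sqrtr_ge0.
have mN : measurable_fun setT N.
  rewrite /N; under eq_fun do rewrite sumE.
  apply: measurable_funM => //; apply: measurable_sum => t.
  apply: measurable_fun_sqrt; apply: measurable_sum => i.
  apply: measurable_funX; exact: (mG (t, i)).
have iN : P.-integrable setT (EFin \o N).
  by apply: integrable_dominated mN _ iZT => w; rewrite ger0_norm.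
rewrite unlock.
have -> : (\int[P]_w (N w)%:E)%E = (\int[P]_w N w)%:E.
  by rewrite /Rintegral fineK//; exact: integrable_fin_num.
rewrite lee_fin (le_trans (le_expectation iN iZT NZ))// RintegralZl//.
rewrite mulrC ler_pdivrMr ?sqrtr_gt0 ?ltr0n//.
apply: (le_trans EZ); rewrite (lpnorm_horizon _ _ sigma0).
have lp0 : 0 <= lpnorm p sigma by exact: powR_ge0.
have sT : Num.sqrt T%:R != 0 :> R by rewrite gt_eqF// sqrtr_gt0 ltr0n.
rewrite -(sqrt_horizon_rate T0 p0).
have -> : 2 * (A / Num.sqrt T%:R + Num.sqrt (B * lpnorm p sigma) *
      (Num.sqrt (T%:R `^ p^-1) / Num.sqrt T%:R)) * Num.sqrt T%:R =
    2 * A + 2 * (Num.sqrt (B * lpnorm p sigma) * Num.sqrt (T%:R `^ p^-1)).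
  by field.
rewrite -sqrtrM ?mulr_ge0//.
have c0 : 0 <= B * lpnorm p sigma * T%:R `^ p^-1 by rewrite !mulr_ge0// powR_ge0.
apply: lerD.
  have := sqrtr_ge0 (lambda * Delta / gamma); rewrite /A -addrA -/B; lra.
have -> : 2 * B * (T%:R `^ p^-1 * lpnorm p sigma) =
  2 * (B * lpnorm p sigma * T%:R `^ p^-1) by ring.
have two : 2 = Num.sqrt (2 ^+ 2) :> R by rewrite sqrtr_sqr ger0_norm.
rewrite [in leRHS]two -sqrtrM ?sqr_ge0//; apply: ler_wsqrtr.
by rewrite ler_wpM2r// expr2; lra.
Qed.
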